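(* Let $r\in\mathbb R_{\ge2}$ be irrational. Below, $a/b$, $c/d$ and $p_n/q_n$ denote elements of $\mathbb Q_{\ge2}$. (a) For every $F\in\mathcal X_\infty$, $$F(E_r^{\mathrm c})=F(E_r^{\mathrm o})=\sup_{a/b<r}F(E_{a/b})=\inf_{r<c/d}F(E_{c/d}).$$ In particular, $E_r^{\mathrm c}$ and $E_r^{\mathrm o}$ are asymptotically equivalent. (b) If $p_n/q_n$ converges to $r$, then $E_{p_n/q_n}$ converges to $E_r^{\mathrm o}$ in the asymptotic spectrum distance on $\mathcal G_\infty$.
   Context: Graphs are simple and may be infinite. $E_n$ denotes the graph with $n$ vertices and no edges, $G\sqcup H$ the disjoint union, and $G\boxtimes H$ the strong product: its vertex set is $V(G)\times V(H)$, and distinct $(a,x),(b,y)$ are adjacent iff ($a=b$ or $\{a,b\}\in E(G)$) and ($x=y$ or $\{x,y\}\in E(H)$). A cohomomorphism $G\to H$ is a map $f:V(G)\to V(H)$ such that for all distinct non-adjacent $u,v\in V(G)$ the vertices $f(u),f(v)$ are distinct and non-adjacent in $H$. Write $G\le H$ if there is a cohomomorphism $G\to H$. Write $G\lesssim H$ if there is $f:\mathbb N\to\mathbb N$ with $f(n)=o(n)$ such that $G^{\boxtimes n}\le H^{\boxtimes(n+f(n))}$ for all $n\in\mathbb N$; $G,H$ are asymptotically equivalent if $G\lesssim H$ and $H\lesssim G$. $\mathcal G_\infty$ is the set of all (finite or infinite) graphs with cardinality at most that of $\mathbb R$ and with finite clique covering number (i.e. whose vertex set can be covered by finitely many cliques).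 $\mathcal X_\infty$ is the set of all maps $F:\mathcal G_\infty\to\mathbb R_{\ge 0}$ with $F(G\sqcup H)=F(G)+F(H)$, $F(G\boxtimes H)=F(G)F(H)$, $F(E_n)=n$ for all $n\in\mathbb N$, and $G\le H\Rightarrow F(G)\le F(H)$. The asymptotic spectrum distance on $\mathcal G_\infty$ is $d(G,H)=\sup_{F\in\mathcal X_\infty}|F(G)-F(H)|$, and $G_i$ converges to $H$ if $d(G_i,H)\to0$. For positive integers $p,q$ with $p/q\ge 2$, the fraction graph $E_{p/q}$ has vertex set $\{0,\dots,p-1\}$, and distinct $u,v$ are adjacent iff $u-v \bmod p<q$ or $v-u\bmod p<q$. Let $C$ be a circle of unit circumference, with distance measured along the circle. For $r\in\mathbb R_{\ge2}$, $E_r^{\mathrm o}$ (resp. $E_r^{\mathrm c}$) is the graph with vertex set $C$ in which two distinct vertices are adjacent iff their distance on $C$ is strictly less than $1/r$ (resp. at most $1/r$). *)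

(* Defs.v *)
From HB Require Import structures.
From mathcomp Require Import all_boot all_order all_algebra.
From mathcomp Require Import all_classical all_reals all_analysis.
From mathcomp Require Import zify ring lra.
Set Implicit Arguments.
Unset Strict Implicit.
Unset Printing Implicit Defensive.
Import Order.TTheory GRing.Theory Num.Theory.
Import numFieldNormedType.Exports.
Local Open Scope classical_set_scope.
Local Open Scope ring_scope.

Record sgraph := SGraph {
  vertex :> Type;
  adj : vertex -> vertex -> Prop;
  adj_irrefl : forall x, ~ adj x x;
  adj_sym : forall x y, adj x y -> adj y x }.

Definition edgeless (n : nat) : sgraph :=
  @SGraph 'I_n (fun _ _ => False) (fun _ => id) (fun _ _ => id).

Section DisjointUnion.
Variables G H : sgraph.

Definition dunion_adj (u v : G + H) : Prop :=
  match u, v with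
  | inl a, inl b => adj a b
  | inr x, inr y => adj x y
  | _, _ => False
  end.

Lemma dunion_irrefl u : ~ dunion_adj u u.
Proof. by case: u => a; apply: adj_irrefl. Qed.

Lemma dunion_sym u v : dunion_adj u v -> dunion_adj v u.
Proof. by case: u => a; case: v => b //=; apply: adj_sym. Qed.

Definition dunion : sgraph := SGraph dunion_irrefl dunion_sym.
End DisjointUnion.

Section StrongProduct.
Variables G H : sgraph.

Definition strong_adj (u v : G * H) : Prop :=
  [/\ u <> v, u.1 = v.1 \/ adj u.1 v.1 & u.2 = v.2 \/ adj u.2 v.2].

Lemma strong_irrefl u : ~ strong_adj u u.
Proof. by case. Qed.

Lemma strong_sym u v : strong_adj u v -> strong_adj v u.
Proof.
case=> uv h1 h2; split; first by move=> vu; apply: uv.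
- by case: h1 => [->|/adj_sym]; [left|right].
- by case: h2 => [->|/adj_sym]; [left|right].
Qed.

Definition strong : sgraph := SGraph strong_irrefl strong_sym.
End StrongProduct.

(* The empty product is the one-vertex graph, the unit of [strong]. *)
Fixpoint strong_pow (G : sgraph) (n : nat) : sgraph :=
  if n is m.+1 then strong G (strong_pow G m) else edgeless 1.

Definition is_cohom (G H : sgraph) (f : G -> H) : Prop :=
  forall u v : G, u <> v -> ~ adj u v -> f u <> f v /\ ~ adj (f u) (f v).

Definition cohom_le (G H : sgraph) : Prop := exists f : G -> H, is_cohom f.

(* [R] only serves to express [f n = o(n)]. *)
Definition asymp_le (R : realType) (G H : sgraph) : Prop :=
  exists2 f : nat -> nat,
    (fun n => (f n)%:R : R^o) =o_\oo (fun n => n%:R : R^o) &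
    forall n, cohom_le (strong_pow G n) (strong_pow H (n + f n)).

Definition asymp_equiv (R : realType) (G H : sgraph) : Prop :=
  asymp_le R G H /\ asymp_le R H G.

Definition clique (G : sgraph) (K : set G) : Prop :=
  forall u v, K u -> K v -> u <> v -> adj u v.

Definition clique_cover (G : sgraph) (k : nat) : Prop :=
  exists K : 'I_k -> set G,
    (forall i, clique (K i)) /\ \bigcup_i K i = [set: G].

Record ginf (R : realType) := GInf {
  ginf_graph :> sgraph;
  ginf_card : ([set: ginf_graph] #<= [set: R])%card;
  ginf_cover : exists k, clique_cover ginf_graph k }.

(* Closure of [ginf] under products needs an injection of R * R into R; it is
   obtained by passing through binary sequences. *)
Section CardinalityLemmas.
Variable R : realType.

Lemma card_le_realP (T : Type) :
  ([set: T] #<= [set: R])%card <-> exists f : T -> R, injective f.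
Proof.
split=> [/pcard_injP[f fI]|[f fI]].
  by exists f => x y; apply: fI; rewrite inE.
by apply/pcard_injP; exists f => x y _ _; apply: fI.
Qed.

Definition below_seq (x : R) (n : nat) : bool :=
  if unpickle n is Some q then ratr (q : rat) < x else false.

Lemma below_seq_inj : injective below_seq.
Proof.
suff lt_neq x y : x < y -> below_seq x <> below_seq y.
  move=> x y exy; have [/lt_neq//|/lt_neq ne|//] := ltgtP x y.
  by case: ne.
move=> /rat_in_itvoo[q]; rewrite in_itv/= => /andP[xq qy].
move=> /(congr1 (fun s => s (pickle q))); rewrite /below_seq pickleK qy.
by rewrite ltNge (ltW xq).
Qed.

Definition ternary_sum (s : nat -> bool) (n : nat) : R :=
  \sum_(i < n) (s i)%:R * 3^-1 ^+ i.

Lemma ternary_sumS s n :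
  ternary_sum s n.+1 = ternary_sum s n + (s n)%:R * 3^-1 ^+ n.
Proof. by rewrite /ternary_sum big_ord_recr. Qed.

Lemma ternary_sum_tail s k m : ternary_sum s (k + m) <=
  ternary_sum s k + 3 / 2 * (3^-1 ^+ k - 3^-1 ^+ (k + m)).
Proof.
elim: m => [|m IH]; first by rewrite addn0 subrr mulr0 addr0.
rewrite addnS ternary_sumS exprS.
have p : 0 <= 3^-1 ^+ (k + m) :> R by rewrite exprn_ge0.
by case: (s _) => /=; lra.
Qed.

Lemma ternary_sum_homo s m n : (m <= n)%N -> ternary_sum s m <= ternary_sum s n.
Proof.
move=> /subnK<-; elim: (n - m)%N => [|d IH]//; rewrite addSn ternary_sumS.
by rewrite (le_trans IH)// lerDl mulr_ge0// exprn_ge0.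
Qed.

Definition ternary (s : nat -> bool) : R := sup (range (ternary_sum s)).

Lemma ternary_le s k : ternary s <= ternary_sum s k + 3 / 2 * 3^-1 ^+ k.
Proof.
apply: ge_sup; first by exists (ternary_sum s 0), 0.
move=> _ [n _ <-].
have p m : 0 <= 3^-1 ^+ m :> R by rewrite exprn_ge0.
have [/ternary_sum_homo nk|/ltnW/subnKC <-] := leqP n k.
  by rewrite (le_trans (nk s))// lerDl; have := p k; lra.
rewrite (le_trans (ternary_sum_tail _ _ _))// lerD2l.
by have := p (k + (n - k))%N; lra.
Qed.

Lemma ternary_ge s k : ternary_sum s k <= ternary s.
Proof.
apply: ub_le_sup; last by exists k.
exists (ternary_sum s 0 + 3 / 2) => _ [n _ <-].
have := ternary_sum_tail s 0 n; rewrite add0n expr0.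
have p : 0 <= 3^-1 ^+ n :> R by rewrite exprn_ge0.
by lra.
Qed.

Lemma ternary_inj : injective ternary.
Proof.
move=> s t est; apply/funext => n; apply: contrapT => /eqP stn.
have /ex_minnP[k /eqP nek kmin] : exists k, s k != t k by exists n.
have eqlt i : (i < k)%N -> s i = t i.
  by move=> ik; apply/eqP; apply: contraTT ik => /kmin; rewrite -leqNgt.
have eqk : ternary_sum s k = ternary_sum t k.
  by apply: eq_bigr => i _; rewrite eqlt.
have p : 0 < 3^-1 ^+ k :> R by rewrite exprn_gt0.
have := ternary_le s k.+1; have := ternary_le t k.+1.
have := ternary_ge s k.+1; have := ternary_ge t k.+1.
rewrite est !ternary_sumS eqk exprS.
by case: (s k) nek; case: (t k) => //= _; lra.
Qed.

Definition interleave (s t : nat -> bool) (n : nat) : bool :=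
  if odd n then t n./2 else s n./2.

Lemma interleave_inj s t s' t' :
  interleave s t = interleave s' t' -> s = s' /\ t = t'.
Proof.
move=> e; split; apply/funext => n.
- by have := congr1 (fun u => u n.*2) e; rewrite /interleave odd_double doubleK.
- have := congr1 (fun u => u n.*2.+1) e.
  by rewrite /interleave /= odd_double /= uphalf_double.
Qed.

Lemma card_real_prod : ([set: R * R] #<= [set: R])%card.
Proof.
apply/card_le_realP.
exists (fun u => ternary (interleave (below_seq u.1) (below_seq u.2))).
move=> [a b] [c d] /ternary_inj/interleave_inj[].
by move=> /below_seq_inj /= -> /below_seq_inj /= ->.
Qed.

Lemma card_le_real_prod (T U : Type) : ([set: T] #<= [set: R])%card ->
  ([set: U] #<= [set: R])%card -> ([set: T * U] #<= [set: R])%card.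
Proof.
move=> /card_le_realP[f fI] /card_le_realP[g gI].
have /card_le_realP[h hI] := card_real_prod.
apply/card_le_realP; exists (fun u => h (f u.1, g u.2)).
by move=> [a b] [c d] /hI[/fI/= -> /gI/= ->].
Qed.

Lemma card_le_real_sum (T U : Type) : ([set: T] #<= [set: R])%card ->
  ([set: U] #<= [set: R])%card -> ([set: T + U] #<= [set: R])%card.
Proof.
move=> /card_le_realP[f fI] /card_le_realP[g gI].
have /card_le_realP[h hI] := card_real_prod.
apply/card_le_realP.
exists (fun u => h (match u with inl a => (f a, 0) | inr b => (g b, 1) end)).
move=> [a|b] [c|d] /hI[].
- by move=> /fI->.
- by move=> _ /esym/eqP; rewrite oner_eq0.
- by move=> _ /eqP; rewrite oner_eq0.
- by move=> /gI->.
Qed.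

Lemma card_le_real_ord n : ([set: 'I_n] #<= [set: R])%card.
Proof.
apply/card_le_realP; exists (fun i => (nat_of_ord i)%:R).
by move=> i j /eqP; rewrite eqr_nat => /eqP /val_inj.
Qed.

End CardinalityLemmas.

Lemma dunion_cover (G H : sgraph) k l :
  clique_cover G k -> clique_cover H l -> clique_cover (dunion G H) (k + l).
Proof.
move=> [K [Kc /seteqP[_ Kf]]] [L [Lc /seteqP[_ Lf]]].
exists (fun i => match fintype.split i with
  | inl j => fun u => if u is inl a then K j a else False
  | inr j => fun u => if u is inr b then L j b else False end); split.
  move=> i; case: (fintype.split i) => j [a|a] [b|b]//= ha hb ne.
    by apply: (Kc j) => // e; apply: ne; rewrite e.
  by apply: (Lc j) => // e; apply: ne; rewrite e.
apply/seteqP; split=> // -[a|b] _.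
  by have [j _ h] := Kf a I; exists (lshift l j); rewrite // (unsplitK (inl j)).
by have [j _ h] := Lf b I; exists (rshift k j); rewrite // (unsplitK (inr j)).
Qed.

Lemma strong_cover (G H : sgraph) k l :
  clique_cover G k -> clique_cover H l -> exists m, clique_cover (strong G H) m.
Proof.
move=> [K [Kc /seteqP[_ Kf]]] [L [Lc /seteqP[_ Lf]]].
exists #|{: 'I_k * 'I_l}|.
exists (fun i => [set u | K (enum_val i).1 u.1 /\ L (enum_val i).2 u.2]); split.
  move=> i u v [/= ku lu] [kv lv] uv; split=> //.
    by have [->|ne] := pselect (u.1 = v.1); [left|right; apply: Kc ku kv ne].
  by have [->|ne] := pselect (u.2 = v.2); [left|right; apply: Lc lu lv ne].
apply/seteqP; split=> // -[a b] _.
have [i _ Ka] := Kf a I; have [j _ Lb] := Lf b I.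
by exists (enum_rank (i, j)) => //=; rewrite enum_rankK.
Qed.

Lemma ord_cover n (G : sgraph) (f : 'I_n -> G) :
  (forall v, exists i, f i = v) -> clique_cover G n.
Proof.
move=> fs; exists (fun i => [set f i]); split.
  by move=> i u v -> -> /(_ erefl).
by apply/seteqP; split=> // v _; have [i <-] := fs v; exists i.
Qed.

Lemma clique_cover_le (G : sgraph) k :
  clique_cover G k -> cohom_le G (edgeless k).
Proof.
move=> [K [Kc /seteqP[_ Kf]]].
have /choice[f fP] : forall v, exists i, K i v.
  by move=> v; have [i _ h] := Kf v I; exists i.
exists f => u v uv nuv; split=> // e; apply: nuv.
by apply: (Kc (f u)); rewrite // {1}e.
Qed.

Section InfiniteGraphs.
Variable R : realType.

Definition ginf_edgeless (n : nat) : ginf R :=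
  @GInf R (edgeless n) (card_le_real_ord R n)
    (ex_intro _ n (@ord_cover n (edgeless n) id (fun v => ex_intro _ v erefl))).

Lemma ginf_dunion_cover (G H : ginf R) : exists k, clique_cover (dunion G H) k.
Proof.
have [k hk] := ginf_cover G; have [l hl] := ginf_cover H.
by exists (k + l)%N; apply: dunion_cover.
Qed.

Definition ginf_dunion (G H : ginf R) : ginf R :=
  @GInf R (dunion G H) (card_le_real_sum (ginf_card G) (ginf_card H))
    (ginf_dunion_cover G H).

Lemma ginf_strong_cover (G H : ginf R) : exists k, clique_cover (strong G H) k.
Proof.
have [k hk] := ginf_cover G; have [l hl] := ginf_cover H.
exact: strong_cover hk hl.
Qed.

Definition ginf_strong (G H : ginf R) : ginf R :=
  @GInf R (strong G H) (card_le_real_prod (ginf_card G) (ginf_card H))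
    (ginf_strong_cover G H).

(* A plain predicate, because [set (ginf R -> R)] is a universe inconsistency. *)
Definition asymp_spectrum (F : ginf R -> R) : Prop :=
  [/\ forall G, 0 <= F G,
      forall G H, F (ginf_dunion G H) = F G + F H,
      forall G H, F (ginf_strong G H) = F G * F H,
      forall n, F (ginf_edgeless n) = n%:R &
      forall G H : ginf R, cohom_le G H -> F G <= F H].

Definition spectrum_dist (G H : ginf R) : R :=
  sup [set x | exists2 F, asymp_spectrum F & x = `|F G - F H|].

(* The supremum above is that of a bounded set of nonnegative reals, so the
   default value 0 of [sup] is never used for an unbounded set. *)
Lemma spectrum_dist_bounded (G H : ginf R) :
  has_ubound [set x | exists2 F, asymp_spectrum F & x = `|F G - F H|].
Proof.
have [k hk] := ginf_cover G; have [l hl] := ginf_cover H.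
exists (k%:R + l%:R) => _ [F [F0 _ _ FE Fle] ->].
have := Fle _ (ginf_edgeless k) (clique_cover_le hk); rewrite FE.
have := Fle _ (ginf_edgeless l) (clique_cover_le hl); rewrite FE.
by rewrite ler_norml; have := F0 G; have := F0 H => *; apply/andP; split; lra.
Qed.

Definition spectrum_cvg (G : nat -> ginf R) (H : ginf R) : Prop :=
  (fun n => spectrum_dist (G n) H) @ \oo --> (0 : R).

Section FractionGraph.
Variables p q : nat.

Definition fraction_adj (u v : 'I_p) : Prop := u <> v /\
  (((u%:Z - v%:Z) %% p%:Z < q%:Z)%Z \/ ((v%:Z - u%:Z) %% p%:Z < q%:Z)%Z).

Lemma fraction_irrefl u : ~ fraction_adj u u.
Proof. by case. Qed.

Lemma fraction_sym u v : fraction_adj u v -> fraction_adj v u.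
Proof. by case=> uv h; split; [move=> /esym|case: h; [right|left]]. Qed.

Definition fraction_graph : sgraph := SGraph fraction_irrefl fraction_sym.

Definition ginf_fraction : ginf R :=
  @GInf R fraction_graph (card_le_real_ord R p)
    (ex_intro _ p (@ord_cover p fraction_graph id (fun v => ex_intro _ v erefl))).

End FractionGraph.

(* The circle R/Z, represented by its fundamental domain [0, 1[. *)
Definition circle : Type := {x : R | 0 <= x < 1}.

Definition circle_dist (x y : circle) : R :=
  Num.min `|val x - val y| (1 - `|val x - val y|).

Lemma circle_distC x y : circle_dist x y = circle_dist y x.
Proof. by rewrite /circle_dist distrC. Qed.

Lemma card_le_real_circle : ([set: circle] #<= [set: R])%card.
Proof. by apply/card_le_realP; exists val; apply: val_inj. Qed.

Section CircleGraphs.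
Variable r : R.

Definition circle_open_adj (x y : circle) : Prop :=
  x <> y /\ circle_dist x y < r^-1.

Definition circle_closed_adj (x y : circle) : Prop :=
  x <> y /\ circle_dist x y <= r^-1.

Lemma circle_open_irrefl x : ~ circle_open_adj x x.
Proof. by case. Qed.

Lemma circle_open_sym x y : circle_open_adj x y -> circle_open_adj y x.
Proof. by case=> xy h; split; [move=> /esym|rewrite circle_distC]. Qed.

Lemma circle_closed_irrefl x : ~ circle_closed_adj x x.
Proof. by case. Qed.

Lemma circle_closed_sym x y : circle_closed_adj x y -> circle_closed_adj y x.
Proof. by case=> xy h; split; [move=> /esym|rewrite circle_distC]. Qed.

Definition circle_open : sgraph := SGraph circle_open_irrefl circle_open_sym.

Definition circle_closed : sgraph :=
  SGraph circle_closed_irrefl circle_closed_sym.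

Hypothesis r_ge2 : 2 <= r.

Lemma circle_open_cover : exists k, clique_cover circle_open k.
Proof.
have r0 : 0 < r by rewrite (lt_le_trans _ r_ge2).
pose N := (Num.truncn r).+1.
have rN : r < N%:R by apply: truncnS_gt.
have N0 : 0 < N%:R :> R by rewrite ltr0n.
exists N.
exists (fun i => [set x : circle | i%:R <= val x * N%:R < i%:R + 1]); split.
  move=> i x y /andP[ax bx] /andP[ay by'] xy; split=> //.
  rewrite /circle_dist gt_min; apply/orP; left.
  rewrite -(ltr_pM2r N0) -{1}(ger0_norm (ltW N0)) -normrM mulrBl.
  have h : 1 < r^-1 * N%:R by rewrite mulrC ltr_pdivlMr// mul1r.
  by rewrite (lt_trans _ h)// ltr_norml; apply/andP; split; lra.
apply/seteqP; split=> // -[x x01] _; have /andP[x0 x1] := x01.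
have xN0 : 0 <= x * N%:R by rewrite mulr_ge0// ltW.
have lt : (Num.truncn (x * N%:R)%R < N)%N.
  rewrite -(ltr_nat R) (@le_lt_trans _ _ (x * N%:R)) ?truncn_le//.
  by rewrite -[ltRHS]mul1r ltr_pM2r.
by exists (Ordinal lt); rewrite //= natr1 truncn_itv.
Qed.

Lemma circle_closed_cover : exists k, clique_cover circle_closed k.
Proof.
have [k [K [Kc Kf]]] := circle_open_cover; exists k, K; split=> // i x y Kx Ky.
by move=> /(Kc i x y Kx Ky)[xy /ltW].
Qed.

Definition ginf_circle_open : ginf R :=
  @GInf R circle_open card_le_real_circle circle_open_cover.

Definition ginf_circle_closed : ginf R :=
  @GInf R circle_closed card_le_real_circle circle_closed_cover.

End CircleGraphs.
End InfiniteGraphs.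

(* Main.v *)
Require Import Defs.
From mathcomp Require Import all_boot all_order all_algebra.
From mathcomp Require Import all_classical all_reals all_analysis.
From mathcomp Require Import zify lra.
Import Order.TTheory GRing.Theory Num.Theory.
Import numFieldNormedType.Exports.
Local Open Scope classical_set_scope.
Local Open Scope ring_scope.
Set Implicit Arguments.
Unset Strict Implicit.
Unset Printing Implicit Defensive.

(** Every graph in the theorem lies in one chain of cohomomorphisms: if
    a/b < r < c/d then
      E_{a/b} <= E_r^c <= E_r^o <= E_{c/d},
    where a fraction graph enters the circle by i |-> i/a and leaves it by
    x |-> floor (c x) ([fraction_le_circle_closed], [circle_closed_le_open],
    [circle_open_le_fraction]).  So everything follows once the two ends of the
    chain can be made asymptotically close, uniformly in the spectral point F.

    Choose a/b and c/d to be Farey neighbours, c b = a d + 1.  Then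
    x |-> floor (x a / c) preserves non-adjacency from E_{c/d} to E_{a/b} as soon
    as the vertex 0 is deleted ([fraction_remove_vertex]), and by rotation any
    other vertex may be deleted instead.  A vertex of the n-th strong power of
    E_{c/d} is a word with n letters, so it avoids at least one of the vertices
    0, ..., n (they exist when n < c); applying to every letter the map that is
    good off that vertex gives, with n + 1 disjoint copies of the target,
      E_{c/d}^n <= E_{n+1} * E_{a/b}^n      ([fraction_pow_le]).
    Hence F(E_{c/d}) <= (n+1)^(1/n) F(E_{a/b}), and the factor tends to 1.  For r
    irrational, mediants give Farey neighbours around r with c, hence n, as
    large as desired ([farey_pairs]); since F(E_r^c) is at most a clique covering
    number of E_r^c for all F, the gap F(E_{c/d}) - F(E_{a/b}) is uniformly
    small ([spectrum_gap]).  This gives the sup and inf formulas, and the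
    convergence because E_{p_n/q_n} is eventually caught between the two ends.

    The asymptotic equivalence comes from the same covering: E_{n+1} maps to the
    power of E_r^c of exponent ceil(log2 (n+1)), because r > 2 makes antipodal
    points non-adjacent, so that
      (E_r^o)^n <= (E_r^c)^(n + ceil(log2 (n+1)))   ([circle_open_pow_le]). *)

(** * Distinguishable vertices and strong powers *)

(** A cohomomorphism is a map preserving this relation, the complement of
    equal-or-adjacent.  Its merit is that a strong product distinguishes two
    pairs exactly when one of the two coordinates does. *)
Definition distinguishable (G : sgraph) (u v : G) : Prop := ~ (u = v \/ adj u v).

Definition cohom_on (G H : sgraph) (A : set G) (f : G -> H) : Prop :=
  forall u v, A u -> A v -> distinguishable u v -> distinguishable (f u) (f v).

Lemma distinguishable_sym (G : sgraph) (u v : G) :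
  distinguishable u v -> distinguishable v u.
Proof. by move=> uv [/esym|/adj_sym] h; apply: uv; [left|right]. Qed.

Lemma cohom_onT (G H : sgraph) (f : G -> H) : cohom_on setT f <-> is_cohom f.
Proof.
split=> fP u v.
  move=> uv nuv; apply/not_orP; apply: fP => //.
  by apply/not_orP.
by move=> _ _ /not_orP[uv nuv]; apply/not_orP/fP.
Qed.

Lemma cohom_leP (G H : sgraph) : cohom_le G H <->
  exists f : G -> H,
    forall u v, distinguishable u v -> distinguishable (f u) (f v).
Proof.
split=> -[f fP]; exists f.
  by move=> u v; move/cohom_onT: fP; apply.
by apply/cohom_onT => u v _ _; apply: fP.
Qed.

Lemma cohom_le_refl (G : sgraph) : cohom_le G G.
Proof. by apply/cohom_leP; exists id. Qed.

Lemma cohom_le_trans (G H K : sgraph) :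
  cohom_le G H -> cohom_le H K -> cohom_le G K.
Proof.
move=> /cohom_leP[f fP] /cohom_leP[g gP]; apply/cohom_leP.
by exists (g \o f) => u v /fP/gP.
Qed.

Lemma strong_distinguishableP (G H : sgraph) (u v : strong G H) :
  distinguishable u v <-> distinguishable u.1 v.1 \/ distinguishable u.2 v.2.
Proof.
split.
  move=> nuv; rewrite /distinguishable -not_andP => -[h1 h2]; apply: nuv.
  by have [|ne] := pselect (u = v); [left|right].
by move=> [] h [e|[_ h1 h2]]; apply: h => //; left; rewrite e.
Qed.

Lemma cohom_le_strong (G G' H H' : sgraph) :
  cohom_le G G' -> cohom_le H H' -> cohom_le (strong G H) (strong G' H').
Proof.
move=> /cohom_leP[f fP] /cohom_leP[g gP]; apply/cohom_leP.
exists (fun u => (f u.1, g u.2)) => u v /strong_distinguishableP[/fP|/gP] h.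
  by apply/strong_distinguishableP; left.
by apply/strong_distinguishableP; right.
Qed.

Lemma cohom_le_pow (G H : sgraph) n :
  cohom_le G H -> cohom_le (strong_pow G n) (strong_pow H n).
Proof.
move=> GH; elim: n => [|n IH]; first exact: cohom_le_refl.
exact: cohom_le_strong.
Qed.

Lemma strong_powD (H : sgraph) m n :
  cohom_le (strong (strong_pow H m) (strong_pow H n)) (strong_pow H (m + n)).
Proof.
elim: m => [|m IH].
  apply/cohom_leP; exists snd => u v /strong_distinguishableP[|//].
  by rewrite [u.1]ord1 [v.1]ord1 => -[]; left.
apply: cohom_le_trans (cohom_le_strong (cohom_le_refl H) IH).
apply/cohom_leP; exists (fun u => (u.1.1, (u.1.2, u.2))) => u v.
by rewrite !strong_distinguishableP/=; tauto.
Qed.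

(** Two distinguishable letters write the binary expansions of the numbers below
    [2 ^ l], and distinct numbers differ in some digit. *)
Lemma edgeless_le_pow (H : sgraph) (x y : H) l N :
  distinguishable x y -> (N <= 2 ^ l)%N ->
  cohom_le (edgeless N) (strong_pow H l).
Proof.
move=> xy Nl.
suff [g gP] : exists g : nat -> strong_pow H l,
    forall i j, (i < 2 ^ l)%N -> (j < 2 ^ l)%N -> i <> j ->
      distinguishable (g i) (g j).
  apply/cohom_leP; exists (fun i => g (val i)) => i j /not_orP[ij _].
  apply: gP => [||/val_inj]; [| |exact: ij].
    exact: leq_trans (ltn_ord (i : 'I_N)) Nl.
  exact: leq_trans (ltn_ord (j : 'I_N)) Nl.
elim: l {Nl} => [|l [g gP]]; first by exists (fun=> ord0) => i j; lia.
exists (fun i => (if odd i then x else y, g i./2)) => i j.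
rewrite expnS => il jl ij; apply/strong_distinguishableP => /=.
have [eij|] := boolP (odd i == odd j); last first.
  by case: (odd i); case: (odd j) => //= _; left => //; apply: distinguishable_sym.
right; apply: gP; first by lia.
  by lia.
by move=> e; apply: ij; rewrite -[i]odd_double_half -[j]odd_double_half e (eqP eij).
Qed.

(** * Covering a strong power by partial cohomomorphisms *)

Fixpoint pow_map (G H : sgraph) (f : G -> H) n :
    strong_pow G n -> strong_pow H n :=
  if n is m.+1 then fun u => (f u.1, pow_map f u.2) else id.

Fixpoint letters (G : sgraph) (T : Type) (w : G -> T) n :
    strong_pow G n -> seq T :=
  if n is m.+1 then fun u => w u.1 :: letters w u.2 else fun=> [::].

Lemma size_letters (G : sgraph) T (w : G -> T) n (u : strong_pow G n) :
  size (letters w u) = n.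
Proof. by elim: n u => //= n IH u; rewrite IH. Qed.

(** [w] labels the vertices and [f] is good off the label [j]: the words none of
    whose letters has that label are exactly where [f] is good letterwise. *)
Lemma pow_map_cohom (G H : sgraph) (T : eqType) (w : G -> T) (j : T)
    (f : G -> H) n :
  cohom_on [set x | w x != j] f ->
  cohom_on [set u | j \notin letters w u] (@pow_map G H f n).
Proof.
move=> fP; elim: n => [|n IH] u v //=.
rewrite !inE !negb_or => /andP[u1 u2] /andP[v1 v2] /strong_distinguishableP[] h.
  by apply/strong_distinguishableP; left; apply: fP => //=; rewrite eq_sym.
by apply/strong_distinguishableP; right; apply: IH.
Qed.

(** Pigeonhole: a word of length [n] carries at most [n] labels, so it misses one
    of the labels [0, ..., n].  The missed label, recorded in the edgeless factor,
    separates words treated by different maps, and words treated by the same map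
    are in its domain. *)
Lemma pow_le_of_partial (G H : sgraph) n (w : G -> nat) (f : nat -> G -> H) :
  (forall j, (j <= n)%N -> cohom_on [set x | w x != j] (f j)) ->
  cohom_le (strong_pow G n) (strong (edgeless n.+1) (strong_pow H n)).
Proof.
move=> fP.
have /choice[m mP] (u : strong_pow G n) :
    exists j : 'I_n.+1, val j \notin letters w u.
  apply: contrapT => /forallNP h.
  have : (size (iota 0 n.+1) <= size (letters w u))%N.
    apply: uniq_leq_size; first exact: iota_uniq.
    move=> j; rewrite mem_iota => jn.
    by have /negP := h (Ordinal jn); rewrite negbK.
  by rewrite size_iota size_letters ltnn.
apply/cohom_leP; exists (fun u => (m u, pow_map (f (m u)) u)) => u v uv.
apply/strong_distinguishableP => /=.
have [e|ne] := pselect (m u = m v); last by left=> -[].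
right; rewrite -e; apply: (pow_map_cohom (fP (m u) _)) => //=.
- by rewrite -ltnS.
- exact: mP.
- by rewrite e; exact: mP.
Qed.

(** * Fraction graphs *)

Lemma modz_sub_ord p (u v : nat) : (u < v)%N -> (v < p)%N ->
  ((v%:Z - u%:Z) %% p%:Z)%Z = (v - u)%N%:Z /\
  ((u%:Z - v%:Z) %% p%:Z)%Z = (u + p - v)%N%:Z.
Proof.
move=> uv vp; split; first by rewrite modz_small; lia.
by rewrite -(modzDr (u%:Z - v%:Z)) modz_small; lia.
Qed.

(** The two inequalities say that the forward arcs from [u] to [v] and from [v] to
    [u] both have length at least [q]; together with its converse
    [cohom_on_fraction], this replaces the residues by order on naturals. *)
Lemma fraction_distinguishable p q (u v : fraction_graph p q) : (0 < q)%N ->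
  (val u + q <= val v)%N -> (val v + q <= val u + p)%N -> distinguishable u v.
Proof.
move=> q0 uv vu; have up := ltn_ord u; have vp := ltn_ord v.
move=> [e|[_]]; first by move: uv; rewrite e; lia.
have [||-> ->] := @modz_sub_ord p (val u) (val v); rewrite ?ltz_nat;
  by move: uv vu up vp => /=; lia.
Qed.

Lemma cohom_on_fraction p q (H : sgraph) (A : set (fraction_graph p q))
    (f : fraction_graph p q -> H) :
  (forall u v, A u -> A v -> (val u + q <= val v)%N ->
     (val v + q <= val u + p)%N -> distinguishable (f u) (f v)) ->
  cohom_on A f.
Proof.
move=> fP.
suff lt (u v : 'I_p) : A u -> A v -> (u < v)%N ->
    distinguishable (u : fraction_graph p q) v -> distinguishable (f u) (f v).
  move=> u v Au Av sep.
  have [uv|vu|/val_inj e] := ltngtP (val u) (val v).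
  - exact: lt.
  - by apply/distinguishable_sym/lt => //; apply: distinguishable_sym.
  - by case: sep; left.
move=> Au Av uv /not_orP[ne nadj].
have [e1 e2] := modz_sub_ord uv (ltn_ord v).
apply: fP => //; rewrite leqNgt; apply/negP => h; apply: nadj; split=> //.
  by right; rewrite e1 ltz_nat; move: h uv => /=; lia.
by left; rewrite e2 ltz_nat; move: h uv => /=; lia.
Qed.

(** Fraction graphs are vertex-transitive, so any vertex can play the role of 0. *)
Lemma fraction_rotation p q j : (0 < q)%N -> (j < p)%N ->
  exists s : fraction_graph p q -> fraction_graph p q,
    (forall u v, distinguishable u v -> distinguishable (s u) (s v)) /\
    (forall u, val (s u) = 0%N -> val u = j).
Proof.
move=> q0 jp; have p0 : (0 < p)%N by lia.
pose s (u : 'I_p) := Ordinal (ltn_pmod (u + (p - j)) p0).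
have sE u : (val (s u) = if u < j then u + (p - j) else u - j)%N.
  rewrite /s/=; have up := ltn_ord u; case: ltnP => uj.
    by rewrite modn_small//; lia.
  by rewrite (_ : u + (p - j) = u - j + p)%N ?modnDr ?modn_small//; lia.
exists s; split; last first.
  by move=> u; rewrite sE; case: (ltnP u j) => [?|? /=]; have := ltn_ord u; lia.
suff : @cohom_on (fraction_graph p q) (fraction_graph p q) setT s.
  by move=> h u v; apply: h.
apply: (@cohom_on_fraction p q) => u v _ _ uv vu.
have up := ltn_ord u; have vp := ltn_ord v.
have [uj|uj] := ltnP u j; have [vj|vj] := ltnP v j.
- by apply: fraction_distinguishable; rewrite // !sE uj vj; move: uv vu => /=; lia.
- apply/distinguishable_sym/fraction_distinguishable; rewrite // !sE uj ltnNge vj/=;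
  by move: uv vu => /=; lia.
- by move: uv vu => /=; lia.
- apply: fraction_distinguishable; rewrite // !sE !ltnNge uj vj/=;
  by move: uv vu => /=; lia.
Qed.

(** The map is [x |-> floor (x a / c)].  As [a d = c b - 1], vertices at distance
    at least [d] have values [x a / c] at distance at least [b - 1 / c].  Rounding
    down recovers the missing [1 / c] on the arc from [x] to [y] unless [x a] is a
    multiple of [c], that is, unless [x = 0]; on the arc from [y] back to [x] it
    does so unless [y = 0]. *)
Lemma fraction_remove_vertex a b c d : (0 < a)%N -> (0 < b)%N ->
  (c * b = a * d + 1)%N ->
  exists f : fraction_graph c d -> fraction_graph a b,
    @cohom_on (fraction_graph c d) (fraction_graph a b)
      [set x : 'I_c | val x != 0%N] f.
Proof.
move=> a0 b0 cb.
have [c0|c0] := posnP c; first by move: cb; rewrite c0; lia.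
have fp (x : 'I_c) : (x * a %/ c < a)%N.
  by rewrite ltn_divLR// mulnC ltn_pmul2l.
exists (fun x => Ordinal (fp x)); apply: cohom_on_fraction => x y /= x0 y0 xy yx.
have cop : coprime c a.
  rewrite /coprime -dvdn1 -(dvdn_addr _ (_ : _ %| a * d)%N); last first.
    by rewrite dvdn_mulr// dvdn_gcdr.
  by rewrite -cb dvdn_mulr// dvdn_gcdl.
have rem (z : 'I_c) : val z != 0%N -> (0 < z * a %% c)%N.
  move=> z0; rewrite lt0n; apply: contra z0 => /eqP/eqP; rewrite -/(dvdn _ _).
  rewrite Gauss_dvdl// => /dvdnP[[|k] e]; first by rewrite /= e.
  by have := ltn_ord z; rewrite e mulSn; lia.
have rx := rem x x0; have ry := rem y y0.
have ex := divn_eq (x * a) c; have ey := divn_eq (y * a) c.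
have lx := ltn_pmod (x * a) c0; have ly := ltn_pmod (y * a) c0.
have hxy : (x * a + a * d <= y * a)%N.
  by rewrite [(a * d)%N]mulnC -mulnDl leq_mul2r xy orbT.
have hyx : (y * a + a * d <= x * a + c * a)%N.
  by rewrite [(a * d)%N]mulnC -!mulnDl leq_mul2r yx orbT.
apply: fraction_distinguishable => //=.
  (* Multiplying by c turns the two floor inequalities into linear ones. *)
  rewrite -ltnS -(ltn_pmul2r c0) mulSn mulnDl [(b * c)%N]mulnC cb; lia.
rewrite -ltnS -(ltn_pmul2r c0) mulSn !mulnDl [(b * c)%N]mulnC cb; lia.
Qed.

Lemma fraction_pow_le a b c d n : (0 < a)%N -> (0 < b)%N -> (0 < d)%N ->
  (c * b = a * d + 1)%N -> (n < c)%N ->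
  cohom_le (strong_pow (fraction_graph c d) n)
    (strong (edgeless n.+1) (strong_pow (fraction_graph a b) n)).
Proof.
move=> a0 b0 d0 cb nc; have [f fP] := fraction_remove_vertex a0 b0 cb.
have /choice[s sP] (j : nat) : exists s : fraction_graph c d -> fraction_graph c d,
    (j < c)%N -> (forall u v, distinguishable u v -> distinguishable (s u) (s v)) /\
      (forall u, val (s u) = 0%N -> val u = j).
  have [jc|cj] := ltnP j c; last by exists id.
  by have [s sP] := fraction_rotation d0 jc; exists s.
apply: (@pow_le_of_partial (fraction_graph c d) (fraction_graph a b) n
  (fun u : 'I_c => val u) (fun j => f \o s j)).
(* The rotation s j carries the vertex j to the deleted vertex 0. *)
move=> j jn u v /= uj vj uv.
have [s1 s2] := sP j (leq_ltn_trans jn nc).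
apply: fP; last exact: s1.
  by apply: contra uj => /eqP/s2 ->.
by apply: contra vj => /eqP/s2 ->.
Qed.

(** * Circle graphs between fraction graphs *)

Section CircleSandwich.
Variable R : realType.
Implicit Types (s : R) (x y : circle R).

Lemma circle_open_distinguishableP s x y : 0 < s ->
  distinguishable (x : circle_open s) y <-> s^-1 <= circle_dist x y.
Proof.
move=> s0; split=> [/not_orP[xy nadj]|sxy [e|[_]]].
- by rewrite leNgt; apply/negP => h; apply: nadj.
- move: sxy; rewrite -e /circle_dist subrr normr0 subr0 min_l// leNgt.
  by rewrite invr_gt0 s0.
- by rewrite ltNge sxy.
Qed.

Lemma circle_closed_distinguishableP s x y : 0 < s ->
  distinguishable (x : circle_closed s) y <-> s^-1 < circle_dist x y.
Proof.
move=> s0; split=> [/not_orP[xy nadj]|sxy [e|[_]]].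
- by rewrite ltNge; apply/negP => h; apply: nadj.
- move: sxy; rewrite -e /circle_dist subrr normr0 subr0 min_l// ltNge.
  by rewrite invr_ge0 ltW.
- by rewrite leNgt sxy.
Qed.

Lemma circle_closed_le_open s :
  0 < s -> cohom_le (circle_closed s) (circle_open s).
Proof.
move=> s0; apply/cohom_leP; exists id => x y.
by rewrite (circle_closed_distinguishableP _ _ s0) => /ltW /(circle_open_distinguishableP _ _ s0).
Qed.

Lemma fraction_points a : (0 < a)%N -> exists pt : 'I_a -> circle R,
  forall b (i j : 'I_a), (i + b <= j)%N -> (j + b <= i + a)%N ->
    b%:R / a%:R <= circle_dist (pt i) (pt j).
Proof.
move=> a0; have a0' : 0 < a%:R :> R by rewrite ltr0n.
have p (i : 'I_a) : 0 <= (i%:R / a%:R : R) < 1.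
  by rewrite divr_ge0//= ltr_pdivrMr// mul1r ltr_nat.
exists (fun i : 'I_a => (exist _ (i%:R / a%:R) (p i) : circle R)) => b i j ij ji.
have ij' : i%:R + b%:R <= j%:R :> R by rewrite -natrD ler_nat.
have ji' : j%:R + b%:R <= i%:R + a%:R :> R by rewrite -!natrD ler_nat.
have b0 : 0 <= b%:R :> R by [].
rewrite /circle_dist /= -mulrBl normrM distrC (ger0_norm (_ : 0 <= j%:R - i%:R)); last first.
  lra.
rewrite ger0_norm ?invr_ge0// le_min ler_pM2r ?invr_gt0//.
apply/andP; split; first by lra.
by rewrite ler_pdivrMr// mulrBl mul1r divfK ?gt_eqF//; lra.
Qed.

Lemma fraction_le_circle_open a b s : (0 < a)%N -> (0 < b)%N ->
  a%:R <= s * b%:R -> cohom_le (fraction_graph a b) (circle_open s).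
Proof.
move=> a0 b0 asb.
have a0' : 0 < a%:R :> R by rewrite ltr0n.
have b0' : 0 < b%:R :> R by rewrite ltr0n.
have s0 : 0 < s by rewrite -(pmulr_lgt0 _ b0') (lt_le_trans a0').
have [pt ptP] := fraction_points a0.
exists (pt : fraction_graph a b -> circle_open s); apply/cohom_onT.
apply: cohom_on_fraction => u v _ _ uv vu.
apply/circle_open_distinguishableP => //; apply: le_trans (ptP b _ _ uv vu).
by rewrite ler_pdivlMr// ler_pdivrMl.
Qed.

Lemma fraction_le_circle_closed a b s : (0 < a)%N -> (0 < b)%N ->
  a%:R < s * b%:R -> cohom_le (fraction_graph a b) (circle_closed s).
Proof.
move=> a0 b0 asb.
have a0' : 0 < a%:R :> R by rewrite ltr0n.
have b0' : 0 < b%:R :> R by rewrite ltr0n.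
have s0 : 0 < s by rewrite -(pmulr_lgt0 _ b0') (lt_trans a0').
have [pt ptP] := fraction_points a0.
exists (pt : fraction_graph a b -> circle_closed s); apply/cohom_onT.
apply: cohom_on_fraction => u v _ _ uv vu.
apply/circle_closed_distinguishableP => //; apply: lt_le_trans (ptP b _ _ uv vu).
by rewrite ltr_pdivlMr// ltr_pdivrMl.
Qed.

(** The map is [x |-> floor (c x)].  Scaling by [c] turns arcs of length at least
    [1 / s] into arcs of length at least [d], and since [d] is an integer the
    bound survives rounding the end points down. *)
Lemma circle_open_le_fraction c d s : (0 < d)%N -> 0 < s ->
  s * d%:R <= c%:R -> cohom_le (circle_open s) (fraction_graph c d).
Proof.
move=> d0 s0 sdc.
have d0' : 0 < d%:R :> R by rewrite ltr0n.
have c0 : 0 < c%:R :> R by apply: lt_le_trans sdc; rewrite mulr_gt0.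
have xc (x : circle R) : (Num.truncn (c%:R * val x) < c)%N.
  have /andP[x0 x1] := valP x.
  by rewrite truncn_lt_nat ?mulr_ge0// gtr_pMr.
apply/cohom_leP; exists (fun x => Ordinal (xc x)).
suff lt x y : val x < val y -> s^-1 <= circle_dist x y ->
    distinguishable (Ordinal (xc x) : fraction_graph c d) (Ordinal (xc y)).
  move=> x y /(circle_open_distinguishableP _ _ s0) xy.
  have [h|h|/val_inj e] := ltgtP (val x) (val y); first exact: lt.
    by apply/distinguishable_sym/lt; rewrite // circle_distC.
  by have /(circle_open_distinguishableP _ _ s0) [] := xy; left.
move=> xy; have /andP[x0 x1] := valP x; have /andP[y0 y1] := valP y.
rewrite /circle_dist distrC gtr0_norm ?subr_gt0// le_min => /andP[h1 h2].
have dcs : d%:R <= c%:R * s^-1 by rewrite ler_pdivlMr// mulrC.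
have k1 : d%:R <= c%:R * (val y - val x).
  by rewrite (le_trans dcs)// ler_pM2l.
have k2 : d%:R <= c%:R * (1 - (val y - val x)).
  by rewrite (le_trans dcs)// ler_pM2l.
have tx : (Num.truncn (c%:R * val x))%:R <= c%:R * val x.
  by rewrite truncn_le mulr_ge0.
have ty : (Num.truncn (c%:R * val y))%:R <= c%:R * val y.
  by rewrite truncn_le mulr_ge0.
have Sx := truncnS_gt (c%:R * val x).
move: k1 k2 tx ty Sx => /= k1 k2 tx ty Sx.
apply: fraction_distinguishable => //=.
  by rewrite truncn_ge_nat ?mulr_ge0// natrD; lra.
by rewrite -ltnS -addSn -(ltr_nat R) !natrD; lra.
Qed.

(** Monotonicity of fraction graphs, obtained by passing through the open circle
    graph with parameter [a / b]. *)
Lemma fraction_le a b c d : (0 < a)%N -> (0 < b)%N -> (0 < d)%N ->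
  a%:R / b%:R <= c%:R / d%:R :> R ->
  cohom_le (fraction_graph a b) (fraction_graph c d).
Proof.
move=> a0 b0 d0 h.
have a0' : 0 < a%:R :> R by rewrite ltr0n.
have b0' : 0 < b%:R :> R by rewrite ltr0n.
apply: (@cohom_le_trans _ (circle_open (a%:R / b%:R : R))).
  by apply: fraction_le_circle_open; rewrite // divfK ?gt_eqF.
by apply: circle_open_le_fraction; rewrite ?divr_gt0// -ler_pdivlMr ?ltr0n.
Qed.

End CircleSandwich.

(** * Farey neighbours of an irrational number *)

Lemma irrational_neq_frac (R : realType) (r : R) m n :
  irrational r -> (0 < n)%N -> r * n%:R != m%:R.
Proof.
move=> irr n0; apply/eqP => e; apply: irr.
exists (m%:R / n%:R) => //; rewrite fmorph_div/= !ratr_nat -e mulfK//.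
by rewrite pnatr_eq0 -lt0n.
Qed.

(** Start from consecutive integers.  Add the right end to the left one until the
    sum exceeds [r], which happens because the mediants tend to [c / d > r]; the
    last two fractions are again neighbours, and the numerator on the right has
    grown. *)
Lemma farey_pairs (R : realType) (r : R) M : 2 <= r -> irrational r ->
  exists a b c d : nat, [/\ (0 < b)%N, (0 < d)%N & (2 * b <= a)%N] /\
    [/\ a%:R < r * b%:R, r * d%:R < c%:R, (c * b = a * d + 1)%N & (M < c)%N].
Proof.
move=> r2 irr; elim: M => [|M [a [b [c [d [[b0 d0 ba] [ar rc cb Mc]]]]]]].
  have r0 : 0 <= r by lra.
  have /andP[t1 t2] := truncn_itv r0.
  exists (Num.truncn r), 1%N, (Num.truncn r).+1, 1%N; split; split=> //.
  - by rewrite muln1 truncn_ge_nat.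
  - have := irrational_neq_frac (Num.truncn r) irr (ltn0Sn 0).
    by rewrite mulr1 lt_neqAle t1 andbT eq_sym.
  - by rewrite mulr1.
  - by rewrite !muln1 addn1.
have ex : exists k, r * (b + k * d)%:R < (a + k * c)%:R.
  have pos : 0 < c%:R - r * d%:R by rewrite subr_gt0.
  exists (Num.truncn ((r * b%:R) / (c%:R - r * d%:R))).+1.
  have := truncnS_gt ((r * b%:R) / (c%:R - r * d%:R)).
  move: (Num.truncn _).+1 => k; rewrite ltr_pdivrMr// !natrD !natrM => h.
  have : 0 <= a%:R :> R by [].
  by move: h; rewrite mulrBr mulrDr; lra.
case: (ex_minnP ex) => -[|k] kP kmin.
  by move: kP; rewrite !mul0n !addn0 ltNge ltW.
have c2d : (2 * d <= c)%N.
  rewrite -(ler_nat R) (le_trans _ (ltW rc))// natrM ler_wpM2r//.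
have lo : (a + k * c)%:R < r * (b + k * d)%:R.
  rewrite lt_neqAle eq_sym (irrational_neq_frac _ irr) ?addn_gt0 ?b0//=.
  by rewrite leNgt; apply/negP => /kmin; rewrite ltnn.
exists (a + k * c)%N, (b + k * d)%N, (a + k.+1 * c)%N, (b + k.+1 * d)%N.
split; split=> //.
- by rewrite addn_gt0 b0.
- by rewrite addn_gt0 b0.
- by rewrite mulnDr leq_add// mulnCA leq_mul2l c2d orbT.
- by nia.
- by rewrite mulSn; lia.
Qed.

(** * Spectral points *)

Fixpoint ginf_pow (R : realType) (G : ginf R) n : ginf R :=
  if n is m.+1 then ginf_strong G (ginf_pow G m) else ginf_edgeless R 1.

Lemma ginf_powE (R : realType) (G : ginf R) n :
  ginf_pow G n = strong_pow G n :> sgraph.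
Proof. by elim: n => //= n ->. Qed.

Section Spectrum.
Variables (R : realType) (F : ginf R -> R).
Hypothesis FS : asymp_spectrum F.

Lemma spectrum_pow (G : ginf R) n : F (ginf_pow G n) = F G ^+ n.
Proof.
have [_ _ FM FE _] := FS; elim: n => [|n IH] /=; first by rewrite FE.
by rewrite FM IH exprS.
Qed.

Lemma spectrum_pow_le (G H : ginf R) n N :
  cohom_le (strong_pow G n) (strong (edgeless N) (strong_pow H n)) ->
  F G ^+ n <= N%:R * F H ^+ n.
Proof.
have [_ _ FM FE Fle] := FS; rewrite -!spectrum_pow -FE -FM => h.
by apply: Fle; rewrite /= !ginf_powE.
Qed.

End Spectrum.

(** Polynomial against exponential growth: this is what makes the factor [n + 1]
    disappear after taking [n]-th roots. *)
Lemma succ_le_expr (R : realType) (e : R) : 0 < e ->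
  exists2 n, (0 < n)%N & n.+1%:R <= (1 + e) ^+ n.
Proof.
move=> e0.
have bern m : 1 + m%:R * e <= (1 + e) ^+ m.
  elim: m => [|m IH]; first by rewrite mul0r addr0.
  rewrite exprS -natr1; apply: (@le_trans _ _ ((1 + e) * (1 + m%:R * e))).
    have : 0 <= m%:R * e ^+ 2 by rewrite mulr_ge0// exprn_ge0// ltW.
    by rewrite expr2; lra.
  by rewrite ler_wpM2l//; lra.
have e20 : 0 < e ^+ 2 by rewrite exprn_gt0.
(* For n = 2 m, Bernoulli gives (1 + e)^n >= (1 + m e)^2 >= 1 + m (m e^2), and
   m e^2 > 3 suffices. *)
pose m := (Num.truncn (3 / e ^+ 2)).+1.
have hm : 3 < m%:R * e ^+ 2 by rewrite -ltr_pdivrMr// truncnS_gt.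
have m1 : 1 <= m%:R :> R by rewrite ler1n.
exists (m * 2)%N; first by rewrite muln2 double_gt0.
rewrite exprM -natr1 natrM.
have h : 0 <= m%:R * e by rewrite mulr_ge0// ltW.
have h2 : 0 <= (1 + e) ^+ m by rewrite (le_trans _ (bern m))//; lra.
apply: (@le_trans _ _ ((1 + m%:R * e) ^+ 2)); last first.
  by rewrite ler_sqr ?nnegrE ?bern//; lra.
have : m%:R * 3 <= m%:R * (m%:R * e ^+ 2) by rewrite ler_pM2l ?ltW//; lra.
by rewrite !expr2; nra.
Qed.

(** The pair of fractions is chosen before [F]: this uniformity is what yields
    convergence in the supremum distance. *)
Lemma spectrum_gap (R : realType) (r e : R) (r_ge2 : 2 <= r) :
  irrational r -> 0 < e ->
  exists a b c d : nat, [/\ (0 < b)%N, (0 < d)%N & (2 * b <= a)%N] /\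
    [/\ a%:R / b%:R < r, r < c%:R / d%:R &
       forall F, asymp_spectrum F ->
         [/\ F (ginf_fraction R a b) <= F (ginf_circle_closed r_ge2),
             F (ginf_circle_closed r_ge2) <= F (ginf_circle_open r_ge2),
             F (ginf_circle_open r_ge2) <= F (ginf_fraction R c d) &
             F (ginf_fraction R c d) <= F (ginf_fraction R a b) + e]].
Proof.
move=> irr e0; have [k kP] := ginf_cover (ginf_circle_closed r_ge2).
have k10 : 0 < k%:R + 1 :> R by rewrite natr1.
(* A relative error e / (k + 1) on a quantity at most k costs less than e. *)
have [n n0 nP] := succ_le_expr (divr_gt0 e0 k10).
have [a [b [c [d [[b0 d0 ba] [ar rc cb nc]]]]]] := farey_pairs n r_ge2 irr.
exists a, b, c, d; split=> //.
have r0 : 0 < r by lra.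
have a0 : (0 < a)%N by lia.
rewrite ltr_pdivrMr ?ltr0n// ltr_pdivlMr ?ltr0n//; split=> // F FS.
have [F0 _ _ FE Fle] := FS.
have le1 : F (ginf_fraction R a b) <= F (ginf_circle_closed r_ge2).
  by apply: Fle; apply: fraction_le_circle_closed.
split=> //.
- by apply: Fle; apply: circle_closed_le_open.
- by apply: Fle; apply: circle_open_le_fraction => //; apply: ltW.
have Fk : F (ginf_fraction R a b) <= k%:R.
  by rewrite (le_trans le1)// -FE; apply: Fle; apply: clique_cover_le.
have : F (ginf_fraction R c d) <= (1 + e / (k%:R + 1)) * F (ginf_fraction R a b).
  have e1 : 0 <= 1 + e / (k%:R + 1) by rewrite addr_ge0// divr_ge0// ltW.
  rewrite -(ler_pXn2r n0) ?nnegrE ?mulr_ge0// exprMn.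
  apply: le_trans (ler_wpM2r (exprn_ge0 _ (F0 _)) nP).
  by apply: spectrum_pow_le => //; apply: fraction_pow_le.
move=> /le_trans; apply; rewrite mulrDl mul1r lerD2l mulrAC ler_pdivrMr//.
by rewrite ler_pM2l//; lra.
Qed.

(** * Asymptotic equivalence of the two circle graphs *)

Section AsymptoticEquivalence.
Variables (R : realType) (r : R).
Hypotheses (r_ge2 : 2 <= r) (r_irr : irrational r).

Lemma irrational_gt2 : 2 < r.
Proof.
have := irrational_neq_frac 2 r_irr (ltn0Sn 0).
by rewrite mulr1 lt_neqAle r_ge2 andbT eq_sym.
Qed.

Lemma circle_closed_antipodes :
  exists x y : circle_closed r, distinguishable x y.
Proof.
have p0 : 0 <= (0 : R) < 1 by rewrite lexx ltr01.
have p1 : 0 <= (1 / 2 : R) < 1 by apply/andP; split; lra.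
exists (exist _ 0 p0 : circle R), (exist _ (1 / 2) p1 : circle R).
have r2 := irrational_gt2.
apply/circle_closed_distinguishableP; first by lra.
rewrite /circle_dist/= distrC subr0 ger0_norm ?lt_min//.
have -> : 1 - 1 / 2 = 1 / 2 :> R by lra.
by rewrite andbb div1r ltf_pV2 ?posrE//; lra.
Qed.

(** The Farey pair may depend on [n], since only the number [n.+1] of copies enters
    the bound; taking its right numerator above [n] covers the whole [n]-th power at
    once. *)
Lemma circle_open_pow_le n :
  cohom_le (strong_pow (circle_open r) n)
    (strong_pow (circle_closed r) (n + up_log 2 n.+1)).
Proof.
have [a [b [c [d [[b0 d0 ba] [ar rc cb nc]]]]]] := farey_pairs n r_ge2 r_irr.
have r0 : 0 < r by apply: lt_le_trans r_ge2.
have a0 : (0 < a)%N by lia.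
have [x [y xy]] := circle_closed_antipodes.
rewrite addnC; apply: cohom_le_trans (strong_powD _ _ _).
apply: (@cohom_le_trans _ (strong_pow (fraction_graph c d) n)).
  by apply/cohom_le_pow/circle_open_le_fraction => //; apply: ltW.
apply: cohom_le_trans (fraction_pow_le a0 b0 d0 cb nc) _.
apply: cohom_le_strong.
  by apply: edgeless_le_pow xy _; apply: up_logP.
by apply/cohom_le_pow/fraction_le_circle_closed.
Qed.

Lemma up_log2_littleo :
  (fun n => (up_log 2 n.+1)%:R : R^o) =o_\oo (fun n => n%:R : R^o).
Proof.
(* t^2 <= 4 n for t = up_log 2 n.+1, so t <= eps n once n >= 4 / eps^2. *)
have sq n : (0 < n)%N -> (up_log 2 n.+1 ^ 2 <= 4 * n)%N.
  move=> n0; rewrite up_log_trunc_log//=.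
  have := trunc_logP (isT : (1 < 2)%N) n0.
  suff h t : (t.+1 ^ 2 <= 4 * 2 ^ t)%N.
    by move=> tn; apply: leq_trans (h _) _; rewrite leq_mul2l.
  elim: t => [//|[//|[//|t]]]; rewrite (expnS 2 t.+2) -!mulnn.
  by move: (2 ^ t.+2)%N => P; nia.
apply/eqoP => eps e0; near=> n.
have n0 : (0 < n)%N by near: n; exact: nbhs_infty_gt.
have n0' : 0 < n%:R :> R by rewrite ltr0n.
have en : 4 / eps ^+ 2 <= n%:R by near: n; exact: nbhs_infty_ger.
suff : (up_log 2 n.+1)%:R <= eps * n%:R :> R.
  by move=> h; rewrite !ger0_norm.
have e0' : 0 <= eps by apply: ltW.
rewrite -ler_sqr ?nnegrE ?mulr_ge0// exprMn.
apply: (@le_trans _ _ (4 * n%:R)).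
  by rewrite -natrX -natrM ler_nat sq.
move: en; rewrite ler_pdivrMr ?exprn_gt0// => en.
by rewrite [n%:R ^+ 2]expr2 mulrA ler_pM2r// mulrC.
Unshelve. all: by end_near. Qed.

Lemma circle_asymp_equiv :
  asymp_equiv R (circle_closed r) (circle_open r).
Proof.
have r0 : 0 < r by have := r_ge2; lra.
split; last first.
  by exists (fun n => up_log 2 n.+1); [exact: up_log2_littleo|exact: circle_open_pow_le].
exists (fun=> 0%N).
  apply/eqoP => eps e0; near=> n.
  by rewrite normr0 mulr_ge0// ltW.
by move=> n; rewrite addn0; apply/cohom_le_pow/circle_closed_le_open.
Unshelve. all: by end_near. Qed.

End AsymptoticEquivalence.

(** * The theorem *)

(** The empty set is included, its [sup] being 0 by convention: this bounds a
    supremum over spectral points whether or not there are any. *)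
Lemma sup_norm_le (R : realType) (S : set R) e : 0 <= e ->
  (forall x, S x -> 0 <= x <= e) -> `|sup S| <= e.
Proof.
move=> e0 SP; have [->|/set0P[x Sx]] := eqVneq S set0.
  by rewrite sup0 normr0.
have ubS : ubound S e by move=> y /SP /andP[].
rewrite ger0_norm; first by apply: ge_sup => //; exists x.
have /andP[x0 _] := SP x Sx; apply: le_trans x0 _.
by apply: ub_le_sup => //; exists e.
Qed.

Theorem theorem4p11 (R : realType) (r : R) (r_ge2 : 2 <= r)
    (r_irr : irrational r) :
  ((forall F : ginf R -> R, asymp_spectrum F ->
      [/\ F (ginf_circle_closed r_ge2) = F (ginf_circle_open r_ge2),
          F (ginf_circle_open r_ge2) =
            sup [set x | exists a b : nat,
              [/\ (0 < b)%N, 2 <= a%:R / b%:R :> R, a%:R / b%:R < r &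
                  x = F (ginf_fraction R a b)]] &
          F (ginf_circle_open r_ge2) =
            inf [set x | exists c d : nat,
              [/\ (0 < d)%N, 2 <= c%:R / d%:R :> R, r < c%:R / d%:R &
                  x = F (ginf_fraction R c d)]]]) /\
    asymp_equiv R (ginf_circle_closed r_ge2) (ginf_circle_open r_ge2)) /\
  (forall p q : nat -> nat,
    (forall n, (0 < q n)%N /\ 2 <= (p n)%:R / (q n)%:R :> R) ->
    (fun n => (p n)%:R / (q n)%:R : R) @ \oo --> r ->
    spectrum_cvg (fun n => ginf_fraction R (p n) (q n))
      (ginf_circle_open r_ge2)).
Proof.
have r0 : 0 < r by apply: lt_le_trans r_ge2.
have num_gt0 a b : (0 < b)%N -> 2 <= a%:R / b%:R :> R -> (0 < a)%N.
  by case: a => // b0; rewrite mul0r => h; exfalso; lra.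
have ge2 a b : (0 < b)%N -> (2 * b <= a)%N -> 2 <= a%:R / b%:R :> R.
  by move=> b0 ba; rewrite ler_pdivlMr ?ltr0n// -natrM ler_nat.
split; first (split; last exact: circle_asymp_equiv).
- move=> F FS; have [F0 _ _ _ Fle] := FS.
  have lo a b : (0 < b)%N -> 2 <= a%:R / b%:R :> R -> a%:R / b%:R < r ->
      F (ginf_fraction R a b) <= F (ginf_circle_open r_ge2).
    move=> b0 ab2 abr; apply: Fle; apply: fraction_le_circle_open => //.
      exact: num_gt0 ab2.
    by rewrite -ler_pdivrMr ?ltr0n// ltW.
  have hi c d : (0 < d)%N -> r < c%:R / d%:R ->
      F (ginf_circle_open r_ge2) <= F (ginf_fraction R c d).
    move=> d0 rcd; apply: Fle; apply: circle_open_le_fraction => //.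
    by rewrite -ler_pdivlMr ?ltr0n// ltW.
  split; apply/eqP; rewrite eq_le; apply/andP; split.
  + by apply: Fle; apply: circle_closed_le_open.
  + apply/ler_addgt0Pr => e e0.
    have [a [b [c [d [_ [_ _ /(_ F FS)[h1 h2 h3 h4]]]]]]] := spectrum_gap r_ge2 r_irr e0.
    by lra.
  + apply/ler_addgt0Pr => e e0.
    have [a [b [c [d [[b0 d0 ba] [ar rc /(_ F FS)[h1 h2 h3 h4]]]]]]] :=
      spectrum_gap r_ge2 r_irr e0.
    apply: (@le_trans _ _ (F (ginf_fraction R a b) + e)); first by lra.
    rewrite lerD2r; apply: ub_le_sup; last first.
      by exists a, b; split=> //; apply: ge2.
    by exists (F (ginf_circle_open r_ge2)) => _ [a' [b' [? ? ? ->]]]; apply: lo.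
  + apply: ge_sup.
      have [a [b [c [d [[b0 d0 ba] [ar rc _]]]]]] := spectrum_gap r_ge2 r_irr ltr01.
      by exists (F (ginf_fraction R a b)), a, b; split=> //; apply: ge2.
    by move=> _ [a' [b' [? ? ? ->]]]; apply: lo.
  + apply: lb_le_inf.
      have [a [b [c [d [[b0 d0 ba] [ar rc _]]]]]] := spectrum_gap r_ge2 r_irr ltr01.
      by exists (F (ginf_fraction R c d)), c, d; split=> //; lra.
    by move=> _ [c' [d' [? ? ? ->]]]; apply: hi.
  + apply/ler_addgt0Pr => e e0.
    have [a [b [c [d [[b0 d0 ba] [ar rc /(_ F FS)[h1 h2 h3 h4]]]]]]] :=
      spectrum_gap r_ge2 r_irr e0.
    apply: (@le_trans _ _ (F (ginf_fraction R c d))); last by lra.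
    apply: ge_inf; last by exists c, d; split=> //; lra.
    by exists (F (ginf_circle_open r_ge2)) => _ [c' [d' [? ? ? ->]]]; apply: hi.
- move=> p q pq pqr; apply/cvgrPdist_le => e e0.
  have [a [b [c [d [[b0 d0 ba] [ar rc h]]]]]] := spectrum_gap r_ge2 r_irr e0.
  near=> n.
  have [qn pqn] := pq n; have pn := num_gt0 _ _ qn pqn.
  have lo : a%:R / b%:R < (p n)%:R / (q n)%:R :> R by near: n; exact: cvgr_gt pqr _ ar.
  have hi : (p n)%:R / (q n)%:R < c%:R / d%:R :> R by near: n; exact: cvgr_lt pqr _ rc.
  rewrite sub0r normrN; apply: sup_norm_le; first exact: ltW.
  move=> _ [F FS ->]; rewrite normr_ge0/=.
  have [_ _ _ _ Fle] := FS; have [h1 h2 h3 h4] := h F FS.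
  have k1 : F (ginf_fraction R a b) <= F (ginf_fraction R (p n) (q n)).
    by apply: Fle; apply: (fraction_le (R := R)); rewrite ?ltW//; lia.
  have k2 : F (ginf_fraction R (p n) (q n)) <= F (ginf_fraction R c d).
    by apply: Fle; apply: (fraction_le (R := R)); rewrite ?ltW.
  by rewrite ler_norml; apply/andP; split; lra.
Unshelve. all: by end_near. Qed.
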